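(* Let $\gamma,n$ be odd positive integers and $N$ a positive integer, and suppose $n$ starts an integral loop of length $N$ (for the map $C_\gamma$). Let $\rho$ and $\nu$ be the numbers of zeros and ones in a single period of the characteristic trajectory of $n$, and let $\mathcal{M}_n$ and $\mathcal{R}_n$ be the two $\nu\times\nu$ matrices associated to $n$. Then $$\left|\det(\mathcal{M}_n)\right|=\left|\det(\mathcal{R}_n)\right|.$$
   Context: For an odd positive integer $\gamma$, $C_\gamma:\mathbb{Z}_{>0}\to\mathbb{Z}_{>0}$ is $C_\gamma(x)=3x+\gamma$ if $x$ is odd, $C_\gamma(x)=x/2$ if $x$ is even; $C_\gamma^k$ is the $k$-fold iterate ($C_\gamma^0=\mathrm{id}$). $n$ starts an integral loop of length $N$ if $N$ is the least positive integer with $C_\gamma^N(n)=n$. $\chi_\gamma^i(n)\in\{0,1\}$ is the parity of $C_\gamma^i(n)$ ($1$ if odd, $0$ if even); the characteristic trajectory is $B=(\chi_\gamma^i(n))_{i\ge0}$, and a single period consists of the indices $0\le i\le N-1$. For $n$ odd, let $0=i_0<i_1<\cdots<i_{\nu-1}\le N-1$ be the indices in $[0,N-1]$ with $\chi_\gamma^{i_j}(n)=1$. For $1\le j\le\nu-1$, $m_j$ is the number of zeros of $B$ strictly between positions $i_{j-1}$ and $i_j$, and $m_\nu$ is the number of zeros at positions after $i_{\nu-1}$ and at most $N-1$. Let $|j|_\nu\in\{0,\ldots,\nu-1\}$ be $j$ modulo $\nu$ and $e_{j,k}$ the $\nu\times\nu$ matrix units. Define $\mathcal{P}=\sum_{j=1}^\nu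 e_{j,|j|_\nu+1}$, $\mathcal{D}_n=\sum_{j=1}^\nu 2^{m_j}e_{j,|j|_\nu+1}$ and $\mathcal{M}_n=\sum_{k=1}^{\nu}\mathcal{D}_n^{k-1}\sum_{j=1}^\nu e_{j,k}$ (zeroth powers are the identity). For $1\le i\le\nu$ let $z_i=2^{\frac1\nu\sum_{k=1}^{\nu-1}k\,m_{|i+k-2|_\nu+1}}$ (a positive real number), and define the circulant matrix $\mathcal{R}_n=\sum_{j=1}^{\nu}z_j\mathcal{P}^{j-1}$. *)

(* Defs.v *)
From mathcomp Require Import all_boot all_order all_algebra.
From mathcomp Require Import reals exp.

Set Implicit Arguments.
Unset Strict Implicit.
Unset Printing Implicit Defensive.

Import Order.TTheory GRing.Theory Num.Theory.

(* Extends C_gamma : Z_{>0} -> Z_{>0} to nat by 0 |-> 0; the positive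
   integers are stable under it. *)
Definition collatz (gamma x : nat) : nat :=
  if odd x then 3 * x + gamma else x./2.

Definition starts_loop (gamma n N : nat) : Prop :=
  [/\ 0 < N, iter N (collatz gamma) n = n &
      forall k, 0 < k < N -> iter k (collatz gamma) n <> n].

(* The characteristic trajectory: true stands for 1 and false for 0. *)
Definition chi (gamma n i : nat) : bool := odd (iter i (collatz gamma) n).

Definition num_ones (gamma n N : nat) : nat := count (chi gamma n) (iota 0 N).

Definition num_zeros (gamma n N : nat) : nat :=
  count (predC (chi gamma n)) (iota 0 N).

(* The increasing sequence [:: i_0; ...; i_(nu-1)]. *)
Definition one_positions (gamma n N : nat) : seq nat :=
  filter (chi gamma n) (iota 0 N).

(* The number m_(j+1), for 0 <= j < nu (the index is shifted to start at 0):
   the zeros strictly between i_j and i_(j+1), where reading past the end of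
   one_positions yields N, so that j = nu - 1 counts the zeros after i_(nu-1)
   and up to N - 1. *)
Definition gap (gamma n N j : nat) : nat :=
  let s := one_positions gamma n N in
  count (fun t => (nth N s j < t < nth N s j.+1) && ~~ chi gamma n t)
        (iota 0 N).

Local Open Scope ring_scope.

(* In the matrices below rows, columns, m and z are indexed from 0: m j and
   z_coef m i stand for m_(j+1) and z_(i+1), and the cyclic column index
   |j|_nu + 1 of row j becomes ordS j = (j + 1) mod nu for 0-based j. *)

Definition mxP (R : realType) (nu : nat) : 'M[R]_nu :=
  \sum_(j < nu) delta_mx j (ordS j).

Definition mxD (R : realType) (nu : nat) (m : nat -> nat) : 'M[R]_nu :=
  \sum_(j < nu) 2 ^+ m j *: delta_mx j (ordS j).

Definition mxM (R : realType) (nu : nat) (m : nat -> nat) : 'M[R]_nu :=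
  \sum_(k < nu) mxD R nu m ^+ k *m (\sum_(j < nu) delta_mx j k).

(* The 1-based index |i+k-2|_nu + 1 of m becomes (i + k - 1) mod nu. *)
Definition z_coef (R : realType) (nu : nat) (m : nat -> nat) (i : nat) : R :=
  2 `^ (nu%:R^-1 * \sum_(1 <= k < nu) (k * m ((i + k - 1) %% nu))%N%:R).

Definition mxR (R : realType) (nu : nat) (m : nat -> nat) : 'M[R]_nu :=
  \sum_(j < nu) z_coef R nu m j *: mxP R nu ^+ j.

(* Main.v *)
Require Import Defs.
From mathcomp Require Import all_boot all_order all_algebra.
From mathcomp Require Import reals exp.
From mathcomp Require Import perm.
From mathcomp Require Import ring zify.

Set Implicit Arguments.
Unset Strict Implicit.
Unset Printing Implicit Defensive.

Import Order.TTheory GRing.Theory Num.Theory.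
Local Open Scope ring_scope.

(** Both matrices are the same Hankel matrix in disguise, up to diagonal scalings
    and a permutation of the rows.

    Let m be the sequence of gaps, indexed from 0 to nu - 1, and let S j be
    the sum of the first j terms of m, continued cyclically, and
    rho = S nu. Iterating the weighted shift mxD multiplies successive weights,
    so the entry (i, k) of M is 2 ^ (S (i + k) - S i) (mxME, prefix_sumD). The
    function S is not periodic, since S (j + nu) = S j + rho, but subtracting
    its average slope makes it so: g j = 2 ^ (S j - j * rho / nu) has period
    nu. As j * rho / nu is additive in j, the correction splits into a factor
    for row i and a factor for column k, whence M = A H B with A, B diagonal
    and H i k = g (i + k) (mxM_detrended).

    On the other side, summation by parts in the exponent of z j gives
    z j = c * g (j + nu - 1), where c does not depend on j (z_coef_detrended).
    The entry (i, l) of the circulant R is z (l - i mod nu), hence equals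
    c * g (l + (nu - 1 - i)): R is c times H with its rows in reverse order
    (mxR_detrended). Reversing rows changes the determinant by at most a sign,
    so it remains to see that det A * det B = c ^ nu, an identity between
    exponents of 2 (prod_scalings). *)

(** * Prefix sums of a cyclic sequence *)

Section PrefixSums.
Variables (n : nat) (m : nat -> nat).
Local Notation nu := n.+1.

Definition prefix_sum (j : nat) : nat := (\sum_(t < j) m (t %% nu))%N.
Local Notation S := prefix_sum.

Lemma prefix_sumS j : S j.+1 = (S j + m (j %% nu))%N.
Proof. by rewrite /S big_ord_recr. Qed.

Lemma prefix_sumD i k : S (i + k) = (S i + \sum_(t < k) m ((i + t) %% nu))%N.
Proof.
elim: k => [|k IHk]; first by rewrite big_ord0 !addn0.
by rewrite addnS prefix_sumS IHk big_ord_recr /= addnA.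
Qed.

Lemma prefix_sum_period j : S (j + nu) = (S j + S nu)%N.
Proof.
elim: j => [|j IHj]; first by rewrite {2}/S big_ord0.
by rewrite addSn (prefix_sumS (j + nu)) (prefix_sumS j) IHj modnDr addnAC.
Qed.

Lemma sum_prefix_sum_shift j :
  (\sum_(i < nu) S (j + i) = \sum_(i < nu) S i + j * S nu)%N.
Proof.
elim: j => [|j IHj]; first by rewrite addn0; apply: eq_bigr.
have : (S j + \sum_(i < nu) S (j.+1 + i) =
        \sum_(i < nu) S (j + i) + S (j + nu))%N.
  transitivity (\sum_(i < nu.+1) S (j + i))%N; last by rewrite big_ord_recr.
  rewrite [RHS]big_ord_recl addn0; congr (_ + _)%N.
  by apply: eq_bigr => i _; rewrite /bump addSnnS.
by rewrite IHj prefix_sum_period; lia.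
Qed.

(** Abel summation, S being the primitive of m: this is what turns the exponent
    of a coefficient of R into a value of S, up to the sum of S over a window
    of length nu, which sum_prefix_sum_shift shows to be affine in j. *)
Lemma sum_index_cyclic_window j :
  (\sum_(1 <= k < nu) k * m ((j + k - 1) %% nu) + \sum_(i < nu) S (j + i)
   = nu * S (j + n))%N.
Proof.
rewrite big_add1 big_mkord.
under eq_bigr => k _ do rewrite addnS subn1 /=.
have abel p : (\sum_(k < p) k.+1 * m ((j + k) %% nu)
               + \sum_(i < p.+1) S (j + i) = p.+1 * S (j + p))%N.
  elim: p => [|p IHp]; first by rewrite big_ord0 big_ord1 mul1n.
  rewrite big_ord_recr [in X in (_ + X)%N]big_ord_recr /= addnACA IHp.
  by rewrite addnS prefix_sumS; lia.
exact: abel.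
Qed.

End PrefixSums.

(** * Entries of the two matrices *)

(** A walk of k steps from i along the cycle is forced to end at i + k, and
    collects the weights of the positions that it leaves. *)
Lemma mxD_expE (R : realType) (nu : nat) (m : nat -> nat) (k : nat)
    (i a : 'I_nu) :
  (mxD R nu m ^+ k) i a
  = 2 ^+ (\sum_(t < k) m ((i + t) %% nu)) *+ (a == (i + k) %% nu :> nat)%N.
Proof.
have DE (p q : 'I_nu) : mxD R nu m p q = 2 ^+ m p *+ (q == ordS p).
  rewrite /mxD summxE (big_only1 p) // => [|j jp _].
    by rewrite !mxE !eqxx /= mulr_natr.
  by rewrite !mxE eq_sym (negPf jp) mulr0.
elim: k i => [|k IHk] i.
  by rewrite expr0 big_ord0 addn0 modn_small // mxE -val_eqE /= eq_sym.
rewrite exprS mxE (big_only1 (ordS i)) //; last first.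
  by move=> q /negPf qi _; rewrite DE qi mul0r.
rewrite DE eqxx IHk big_ord_recl /= addn0 modnDml addSnnS.
rewrite (modn_small (ltn_ord i)) exprD mulr1n -mulrnAr; congr (_ * (2 ^+ _ *+ _)).
by apply: eq_bigr => t _; rewrite modnDml addSnnS.
Qed.

Lemma mxP_mxD (R : realType) (nu : nat) : mxP R nu = mxD R nu (fun=> 0%N).
Proof. by apply: eq_bigr => j _; rewrite expr0 scale1r. Qed.

Lemma mxP_expE (R : realType) (nu k : nat) (i a : 'I_nu) :
  (mxP R nu ^+ k) i a = (a == (i + k) %% nu :> nat)%N%:R.
Proof. by rewrite mxP_mxD mxD_expE big1. Qed.

Lemma mxME (R : realType) (n : nat) (m : nat -> nat) (i k : 'I_n.+1) :
  mxM R n.+1 m i k = 2 ^+ (\sum_(t < k) m ((i + t) %% n.+1)).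
Proof.
have ones l (a b : 'I_n.+1) :
    (\sum_(j < n.+1) delta_mx j l : 'M[R]_n.+1) a b = (b == l)%:R.
  rewrite summxE (big_only1 a) ?mxE ?eqxx // => j /negPf ja _.
  by rewrite mxE eq_sym ja.
rewrite /mxM summxE (big_only1 k) // => [|l /negPf lk _]; last first.
  by rewrite mxE big1 // => a _; rewrite ones eq_sym lk mulr0.
have ik : ((i + k) %% n.+1 < n.+1)%N by rewrite ltn_pmod.
rewrite mxE (big_only1 (Ordinal ik)) // => [|a /negPf ha _].
  by rewrite mxD_expE ones /= !eqxx mulr1.
by rewrite mxD_expE -(val_eqE a) in ha *; rewrite ha mul0r.
Qed.

(** * Comparison with a common Hankel matrix *)

Section Determinants.
Variables (R : realType) (n : nat) (m : nat -> nat).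
Local Notation nu := n.+1.
Local Notation S := (prefix_sum n m).

Let slope : R := (S nu)%:R / nu%:R.

Definition detrended_exp (j : nat) : R := 2 `^ ((S j)%:R - j%:R * slope).
Local Notation g := detrended_exp.

Lemma detrended_exp_period j : g (j + nu) = g j.
Proof.
rewrite /g prefix_sum_period; congr (2 `^ _); rewrite !natrD /slope.
by field; rewrite nat1r pnatr_eq0.
Qed.

Lemma detrended_exp_mod j : g (j %% nu) = g j.
Proof.
rewrite {2}(divn_eq j nu); elim: (j %/ nu)%N => [|q IHq]; first by rewrite add0n.
by rewrite mulSn -addnA addnC detrended_exp_period -IHq.
Qed.

Definition detrended_hankel : 'M[R]_nu := \matrix_(i, k) g (i + k).
Local Notation H := detrended_hankel.

(** The linear correction at i + k is the sum of those at i and at k, and the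
    term - S i of the exponent depends on the row only; so both can be pulled
    out of H. *)
Lemma mxM_detrended :
  mxM R nu m = diag_mx (\row_i 2 `^ (i%:R * slope - (S i)%:R)) *m H
               *m diag_mx (\row_k 2 `^ (k%:R * slope)).
Proof.
apply/matrixP => i k; rewrite mul_mx_diag mul_diag_mx !mxE mxME.
have two0 : (2 : R) != 0 by rewrite pnatr_eq0.
rewrite -!powRD ?two0 ?implybT // -powR_mulrn ?ler0n //.
by congr (2 `^ _); rewrite prefix_sumD !natrD; ring.
Qed.

(** The exponent is what is left of that of z j, as computed by
    sum_index_cyclic_window, once S (j + n) - (j + n) * slope is removed; the
    terms in j cancel. *)
Definition circulant_factor : R :=
  2 `^ ((n%:R * (S nu)%:R - (\sum_(i < nu) S i)%:R) / nu%:R).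
Local Notation c := circulant_factor.

Lemma z_coef_detrended j : z_coef R nu m j = c * g (j + n).
Proof.
have two0 : (2 : R) != 0 by rewrite pnatr_eq0.
rewrite /c /g -powRD ?two0 ?implybT //; congr (2 `^ _).
rewrite -natr_sum.
have := congr1 (fun x => x%:R : R) (sum_index_cyclic_window n m j).
rewrite sum_prefix_sum_shift !natrD !natrM => /(canRL (addrK _)) ->.
by rewrite /slope; field; rewrite nat1r pnatr_eq0.
Qed.

(** Row i of the circulant involves z (l - i), that is g at l - i + (nu - 1),
    which is the value at l of the row of H with index rev_ord i = nu - 1 - i. *)
Lemma mxR_detrended :
  mxR R nu m = c *: row_perm (perm (@rev_ord_inj nu)) H.
Proof.
apply/matrixP => i l; rewrite !mxE permE summxE.
have hi := ltn_ord i.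
have il : ((l + nu - i) %% nu < nu)%N by rewrite ltn_pmod.
have solve_shift (j : 'I_nu) :
    (l == (i + j) %% nu :> nat)%N = (j == Ordinal il).
  rewrite -(val_eqE j) /= -{1}(modn_small (ltn_ord l)).
  rewrite -{2}(modn_small (ltn_ord j)) -[RHS](eqn_modDl i).
  by rewrite subnKC ?modnDr 1?eq_sym //; lia.
rewrite (big_only1 (Ordinal il)) // => [|j /negPf jl _]; last first.
  by rewrite mxE mxP_expE solve_shift jl mulr0.
rewrite mxE mxP_expE solve_shift eqxx mulr1 z_coef_detrended; congr (_ * _).
rewrite -[LHS]detrended_exp_mod /= modnDml -[in RHS]detrended_exp_period.
rewrite -[in RHS]detrended_exp_mod /=.
have -> // : (l + nu - i + n = nu - i.+1 + l + nu)%N.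
by clear - hi; lia.
Qed.

(** The linear corrections add up to 2 * slope * (0 + ... + n) = n * S nu, which
    together with the - S i is nu times the exponent of c. *)
Lemma prod_scalings :
  (\prod_(i < nu) 2 `^ (i%:R * slope - (S i)%:R))
  * (\prod_(k < nu) 2 `^ (k%:R * slope)) = c ^+ nu.
Proof.
have two0 : (2 : R) != 0 by rewrite pnatr_eq0.
have prod_powR (f : 'I_nu -> R) : \prod_i 2 `^ f i = 2 `^ (\sum_i f i).
  elim/big_rec2: _ => [|i x y _ ->]; first by rewrite powRr0.
  by rewrite powRD ?two0 ?implybT.
rewrite !prod_powR -powRD ?two0 ?implybT // /c -powR_mulrn ?powR_ge0 //.
rewrite -powRrM; congr (2 `^ _).
rewrite big_split sumrN /= -mulr_suml -!natr_sum.
have -> : (\sum_(i < nu) i)%:R = nu%:R * n%:R / 2 :> R.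
  have := bin2_sum nu; rewrite big_mkord => ->.
  apply: (canRL (mulfK two0)); rewrite -!natrM; congr (_%:R).
  (* nu * n is even, so halving it in the binomial loses nothing. *)
  by rewrite bin2 muln2 -[RHS]odd_double_half /= oddM /= andNb.
by rewrite /slope; field; rewrite nat1r pnatr_eq0.
Qed.

Lemma normr_det_mxM_mxR : `|\det (mxM R nu m)| = `|\det (mxR R nu m)|.
Proof.
rewrite mxM_detrended mxR_detrended !det_mulmx !det_diag detZ row_permE.
rewrite det_mulmx det_perm mulrAC !normrM normr_sign mul1r -!normrM.
rewrite -prod_scalings; congr (`|_ * _ * _|);
  by apply: eq_bigr => i _; rewrite mxE.
Qed.

End Determinants.

Theorem proposition1p5p5 (R : realType) (gamma n N rho nu : nat)
    (hgamma : odd gamma) (hn : odd n) (hN : (0 < N)%N)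
    (hloop : starts_loop gamma n N)
    (hrho : rho = num_zeros gamma n N) (hnu : nu = num_ones gamma n N) :
  `|\det (mxM R nu (gap gamma n N))| = `|\det (mxR R nu (gap gamma n N))|.
Proof.
(* With no ones both matrices are empty. *)
case: nu {hnu} => [|n']; first by rewrite !det_mx00.
exact: normr_det_mxM_mxR.
Qed.
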